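(* Let $e\in\mathbb{S}$, let $k$ be a commutative ring and let $R$ be a (not necessarily commutative) $k$-algebra on which multiplication by every positive integer dividing $e$ is injective. Put $R'=R\otimes_{\mathbb{Z}}\mathbb{Z}[\mu_e]$, $k'=k\otimes_{\mathbb{Z}}\mathbb{Z}[\mu_e]$ and identify $R$ with $R\otimes 1\subseteq R'$. Then the maps $$(R,\mu_e,\{R_\zeta\}_{\zeta\in\mu_e})\;\mapsto\;\big(\text{the }k'\text{-linear map } r\otimes u\mapsto r\otimes \zeta u \text{ for } r\in R_\zeta,\ u\in\mathbb{Z}[\mu_e]\big)$$ and $$\sigma\;\mapsto\;(R,\mu_e,\{R'(\sigma,\zeta)\cap R\}_{\zeta\in\mu_e})$$ are well defined, mutually inverse bijections between the set of $\mu_e$-gradings of $R$ as a $k$-algebra and the set $X_e(R)$.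
   Context: Steinitz numbers $\mathbb{S}$: formal products $\prod_p p^{n_p}$ over primes $p$ with $n_p\in\mathbb{Z}_{\ge0}\cup\{\infty\}$; a positive integer $d$ divides $e=\prod p^{n_p}$ if $\mathrm{ord}_p(d)\le n_p$ for all $p$. $\mu_e\subseteq\mathbb{C}^*$ is the group of roots of unity whose order divides $e$, and $\mathbb{Z}[\mu_e]\subseteq\mathbb{C}$ the ring it generates. $\hat{\mathbb{Z}}/e\hat{\mathbb{Z}}=\varprojlim_{d\mid e,\,d\in\mathbb{Z}_{>0}}\mathbb{Z}/d\mathbb{Z}$; an element $a$ acts on $\mu_e$ by $\zeta\mapsto\zeta^{a}$ (using $a$ mod $\mathrm{ord}(\zeta)$); for $a\in(\hat{\mathbb{Z}}/e\hat{\mathbb{Z}})^*$ this induces a ring automorphism of $\mathbb{Z}[\mu_e]$ and hence a $k$-algebra automorphism $\tau_a=\mathrm{id}_R\otimes(\cdot)$ of $R'$. For an endomorphism $f$ of a module $M$ and $\lambda$ a scalar, $M(f,\lambda)=\{x\in M: f(x)=\lambda x\}$; $f$ is $\mu_e$-diagonalizable if $\bigoplus_{\zeta\in\mu_e}M(f,\zeta)\to M$ is an isomorphism. For such $f$ and $a\in\hat{\mathbb{Z}}/e\hat{\mathbb{Z}}$, $f^a$ is the endomorphism acting on $M(f,\zeta)$ as multiplication by $\zeta^a$. $X_e(R)=\{\sigma\in\mathrm{Aut}_{k'\text{-alg}}(R'):\sigma\text{ is }\mu_e\text{-diagonalizable and }\tau_a\sigma\tau_a^{-1}=\sigma^a\text{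 for all }a\in(\hat{\mathbb{Z}}/e\hat{\mathbb{Z}})^*\}$. A $\mu_e$-grading of $R$ as a $k$-algebra is a family $\{R_\zeta\}_{\zeta\in\mu_e}$ of $k$-submodules with $\bigoplus R_\zeta\to R$ an isomorphism, $1\in R_1$ and $R_\zeta R_\xi\subseteq R_{\zeta\xi}$. *)

(* Defs.v *)
From HB Require Import structures.
From mathcomp Require Import all_boot all_order all_algebra all_field.
Set Implicit Arguments. Unset Strict Implicit. Unset Printing Implicit Defensive.
Import Order.TTheory GRing.Theory Num.Theory.
Local Open Scope ring_scope.

(* Steinitz numbers: exponent n_p at each prime p (None = infinity);
   values at non-primes are irrelevant. *)
Definition steinitz := nat -> option nat.

Definition st_dvd (d : nat) (e : steinitz) : Prop :=
  (0 < d)%N /\ forall p, prime p ->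
    match e p with Some n => (logn p d <= n)%N | None => true end.

Definition mu (e : steinitz) (z : algC) : Prop :=
  exists n, n.-primitive_root z /\ st_dvd n e.

Definition Zmu (e : steinitz) (u : algC) : Prop :=
  exists s : seq (int * seq algC),
    (forall p z, p \in s -> z \in p.2 -> mu e z) /\
    u = \sum_(p <- s) (p.1)%:~R * \prod_(z <- p.2) z.

(* elements of (Zhat / e Zhat): compatible families (a_d mod d)_{d | e} *)
Definition zhat (e : steinitz) (a : nat -> nat) : Prop :=
  (forall d, st_dvd d e -> (a d < d)%N) /\
  (forall d d', st_dvd d e -> (0 < d')%N -> (d' %| d)%N -> a d' = (a d %% d')%N).
Definition zhat_unit (e : steinitz) (a : nat -> nat) : Prop :=
  zhat e a /\ forall d, st_dvd d e -> coprime (a d) d.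

Section Tensor.
Variables (e : steinitz) (k : comPzRingType) (R : algType k) (R' : pzRingType).
Variables (iR : {rmorphism R -> R'}) (iZ : algC -> R').

(* (R', iR, iZ) is the ring R (x)_Z Z[mu_e], with iR r = r (x) 1 and
   iZ u = 1 (x) u : iZ is a ring morphism on Z[mu_e], the images commute,
   and r (x) u := iR r * iZ u satisfies the universal property of the
   tensor product of Z-modules. *)
Definition is_tensor_Zmu : Prop :=
  [/\ iZ 1 = 1,
      (forall u v, Zmu e u -> Zmu e v -> iZ (u + v) = iZ u + iZ v),
      (forall u v, Zmu e u -> Zmu e v -> iZ (u * v) = iZ u * iZ v),
      (forall r u, Zmu e u -> iR r * iZ u = iZ u * iR r) &
      (forall (M : zmodType) (f : R -> algC -> M),
         (forall u, Zmu e u -> forall r s, f (r + s) u = f r u + f s u) ->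
         (forall r u v, Zmu e u -> Zmu e v -> f r (u + v) = f r u + f r v) ->
         (exists g : R' -> M, (forall x y, g (x + y) = g x + g y) /\
            forall r u, Zmu e u -> g (iR r * iZ u) = f r u) /\
         (forall g g' : R' -> M,
            (forall x y, g (x + y) = g x + g y) ->
            (forall x y, g' (x + y) = g' x + g' y) ->
            (forall r u, Zmu e u -> g (iR r * iZ u) = g' (iR r * iZ u)) ->
            forall x, g x = g' x))].

(* k'-linear endomorphism of R', where k' = k (x) Z[mu_e] acts on R'
   through a (x) u |-> iR (a%:A) * iZ u *)
Definition kp_linear (f : R' -> R') : Prop :=
  (forall x y, f (x + y) = f x + f y) /\
  (forall a u x, Zmu e u -> f (iR (a%:A) * iZ u * x) = iR (a%:A) * iZ u * f x).

Definition kp_alg_aut (f : R' -> R') : Prop :=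
  [/\ kp_linear f, f 1 = 1, (forall x y, f (x * y) = f x * f y) & bijective f].

Definition eigen (f : R' -> R') (z : algC) (x : R') : Prop := f x = iZ z * x.

Definition mu_diag (f : R' -> R') : Prop :=
  (forall x, exists (s : seq algC) (g : algC -> R'),
      [/\ uniq s, (forall z, z \in s -> mu e z),
          (forall z, z \in s -> eigen f z (g z)) & x = \sum_(z <- s) g z]) /\
  (forall (s : seq algC) (g : algC -> R'), uniq s -> (forall z, z \in s -> mu e z) ->
      (forall z, z \in s -> eigen f z (g z)) -> \sum_(z <- s) g z = 0 ->
      forall z, z \in s -> g z = 0).

Definition is_pow_endo (f : R' -> R') (a : nat -> nat) (h : R' -> R') : Prop :=
  (forall x y, h (x + y) = h x + h y) /\
  (forall z n x, n.-primitive_root z -> st_dvd n e -> eigen f z x ->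
      h x = iZ (z ^+ a n) * x).

Definition is_tau (a : nat -> nat) (T : R' -> R') : Prop :=
  (forall x y, T (x + y) = T x + T y) /\
  (forall r z n, n.-primitive_root z -> st_dvd n e ->
      T (iR r * iZ z) = iR r * iZ (z ^+ a n)).

Definition X_e (s : R' -> R') : Prop :=
  [/\ kp_alg_aut s, mu_diag s &
      forall a, zhat_unit e a -> forall T Tinv : R' -> R',
        is_tau a T -> cancel T Tinv -> cancel Tinv T ->
        is_pow_endo s a (T \o s \o Tinv)].

Definition mu_grading (G : algC -> R -> Prop) : Prop :=
  [/\ (forall z, mu e z ->
         [/\ G z 0, (forall r s, G z r -> G z s -> G z (r + s))
           & (forall (a : k) r, G z r -> G z (a *: r))]),
      (forall r, exists (s : seq algC) (g : algC -> R),
         [/\ uniq s, (forall z, z \in s -> mu e z),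
             (forall z, z \in s -> G z (g z)) & r = \sum_(z <- s) g z]),
      (forall (s : seq algC) (g : algC -> R), uniq s -> (forall z, z \in s -> mu e z) ->
         (forall z, z \in s -> G z (g z)) -> \sum_(z <- s) g z = 0 ->
         forall z, z \in s -> g z = 0),
      G 1 1 &
      (forall z w r s, mu e z -> mu e w -> G z r -> G w s -> G (z * w) (r * s))].

Definition sigma_of_grading (G : algC -> R -> Prop) (s : R' -> R') : Prop :=
  forall z r u, mu e z -> G z r -> Zmu e u -> s (iR r * iZ u) = iR r * iZ (z * u).

Definition grading_of (s : R' -> R') : algC -> R -> Prop :=
  fun z r => eigen s z (iR r).

End Tensor.

(* Main.v *)
Require Import Defs.
From HB Require Import structures.
From mathcomp Require Import all_boot all_order all_algebra all_field.
From mathcomp Require Import cyclic boolp functions.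
Set Implicit Arguments. Unset Strict Implicit. Unset Printing Implicit Defensive.
Import GRing.Theory.
Local Open Scope ring_scope.

(* Each Z[mu_n] is free over Z, so an element of R' is zero as soon as its coordinates
   with respect to the powers of a primitive n-th root of unity vanish for n | e divisible
   enough; hence R embeds in R' and every d | e is regular on R'.  For z <> w in mu_e the
   difference z - w divides some n | e in Z[mu_e], so it is regular on R' and eigenvectors
   with distinct eigenvalues in mu_e are independent.  Given a grading, the eigenspaces of
   sigma are thus the R_z (x) Z[mu_e], from which membership in X_e is read off.  Given
   sigma in X_e, the sigma-components of an element of R are fixed by every tau_a, and the
   elements of R' fixed by all tau_a are those of R: this is Galois descent from Z[mu_(pd)]
   to Z[mu_d], one prime p at a time.  It suffices to use the a that come from
   automorphisms of the field of algebraic numbers. *)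

(** * Roots of unity and the rings Z[mu_n] *)

Lemma expr1_dvdn (A : pzSemiRingType) (z : A) d n :
  (d %| n)%N -> z ^+ d = 1 -> z ^+ n = 1.
Proof. by move=> /dvdnP[m ->] zd; rewrite mulnC exprM zd expr1n. Qed.

Section Steinitz.
Variable e : steinitz.

Lemma st_dvd1 : st_dvd 1 e.
Proof. by split=> // p _; rewrite logn1; case: (e p). Qed.

Lemma st_dvd_dvdn d n : (d %| n)%N -> st_dvd n e -> st_dvd d e.
Proof.
move=> dn [n0 en]; split=> [|p pp]; first exact: dvdn_gt0 dn.
by have := en p pp; case: (e p) => // m; apply/leq_trans/dvdn_leq_log.
Qed.

Lemma st_dvd_lcmn m n : st_dvd m e -> st_dvd n e -> st_dvd (lcmn m n) e.
Proof.
move=> [m0 em] [n0 en]; split=> [|p pp]; first by rewrite lcmn_gt0 m0.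
by have := em p pp; have := en p pp; rewrite logn_lcm //; case: (e p) => // k;
  rewrite geq_max => -> ->.
Qed.

Lemma muP z : mu e z <-> exists2 n, st_dvd n e & z ^+ n = 1.
Proof.
split=> [[n [pz en]]|[n en zn]]; first by exists n => //; exact: prim_expr_order.
have [m pz mn] := prim_order_exists en.1 zn.
by exists m; split=> //; apply: st_dvd_dvdn en.
Qed.

Lemma mu1 : mu e 1.
Proof. by apply/muP; exists 1%N; [exact: st_dvd1 | rewrite expr1]. Qed.

Lemma muM z w : mu e z -> mu e w -> mu e (z * w).
Proof.
move=> /muP[m em zm] /muP[n en wn]; apply/muP; exists (lcmn m n).
  exact: st_dvd_lcmn.
rewrite exprMn_comm; last exact: mulrC.
by rewrite (expr1_dvdn (dvdn_lcml m n) zm) (expr1_dvdn (dvdn_lcmr m n) wn) mulr1.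
Qed.

Lemma muX z i : mu e z -> mu e (z ^+ i).
Proof.
move=> mz; elim: i => [|i IH]; first by rewrite expr0; exact: mu1.
by rewrite exprS; exact: muM.
Qed.

Lemma muV z : mu e z -> mu e z^-1.
Proof. by move=> /muP[m em zm]; apply/muP; exists m; rewrite // exprVn zm invr1. Qed.

Lemma mu_neq0 z : mu e z -> z != 0.
Proof.
move=> /muP[n [n0 _] zn]; apply: contra_eq_neq zn => ->.
by rewrite expr0n gtn_eqF // eq_sym oner_eq0.
Qed.

End Steinitz.

(** A primitive root of order [n.-1.+1], which makes [zeta] total; at [n = 0] it has order 1. *)
Definition zeta (n : nat) : algC := sval (C_prim_root_exists (ltn0Sn n.-1)).

Lemma zeta_prim n : (0 < n)%N -> n.-primitive_root (zeta n).
Proof.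
by rewrite /zeta; case: C_prim_root_exists => z /= zP n0; rewrite prednK in zP.
Qed.

Definition ev_zeta (n : nat) (p : {poly int}) : algC := (map_poly intr p).[zeta n].

Fact ev_zeta_is_zmod_morphism n : zmod_morphism (ev_zeta n).
Proof. by move=> p q; rewrite /ev_zeta rmorphB hornerD hornerN. Qed.
HB.instance Definition _ n :=
  GRing.isZmodMorphism.Build {poly int} algC (ev_zeta n) (ev_zeta_is_zmod_morphism n).

Fact ev_zeta_is_monoid_morphism n : monoid_morphism (ev_zeta n).
Proof.
split=> [|p q]; first by rewrite /ev_zeta rmorph1 hornerC.
by rewrite /ev_zeta rmorphM hornerM.
Qed.
HB.instance Definition _ n :=
  GRing.isMonoidMorphism.Build {poly int} algC (ev_zeta n) (ev_zeta_is_monoid_morphism n).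

Lemma ev_zetaXn n i : ev_zeta n 'X^i = zeta n ^+ i.
Proof. by rewrite /ev_zeta map_polyXn hornerXn. Qed.

Lemma ev_zetaE n (p : {poly int}) :
  ev_zeta n p = \sum_(i < size p) (p`_i)%:~R * zeta n ^+ i.
Proof.
rewrite {1}[p](esym (coefK p)) poly_def rmorph_sum /=.
by apply: eq_bigr => i _; rewrite -mul_polyC rmorphM /= ev_zetaXn /ev_zeta map_polyC hornerC.
Qed.

Lemma ev_zeta_Cyclotomic n : (0 < n)%N -> ev_zeta n (Cyclotomic n) = 0.
Proof.
move=> n0; rewrite /ev_zeta (Cintr_Cyclotomic (zeta_prim n0)).
by apply/eqP; rewrite -/(root _ _) root_cyclotomic zeta_prim.
Qed.

(** The minimal polynomial of [zeta n] over Q is the cyclotomic polynomial, of degree [totient n],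
    and it divides every rational polynomial that vanishes at [zeta n]. *)
Lemma ev_zeta_inj n (p : {poly int}) :
  (0 < n)%N -> (size p <= totient n)%N -> ev_zeta n p = 0 -> p = 0.
Proof.
move=> n0 sp p0; have zP := zeta_prim n0.
have [pf [Dpf mon_pf] dv_pf] := minCpolyP (zeta n).
have spf : size pf = (totient n).+1.
  by rewrite -(size_map_poly (ratr : rat -> algC)) -Dpf (minCpoly_cyclotomic zP) size_cyclotomic.
have : pf %| map_poly intr p.
  rewrite -dv_pf -map_poly_comp /root; apply/eqP; rewrite -[RHS]p0 /ev_zeta; congr _.[_].
  by apply: eq_map_poly => b; rewrite /= rmorph_int.
have sm : size (map_poly (intr : int -> rat) p) = size p.
  by apply: size_map_inj_poly => //; exact: intr_inj.
have [m0 _|mn0] := eqVneq (map_poly (intr : int -> rat) p) 0.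
  by apply/eqP; rewrite -size_poly_eq0 -sm m0 size_poly0.
by move=> /(dvdp_leq mn0); rewrite sm spf ltnNge sp.
Qed.

(** * Z[mu_e] as the union of the rings Z[mu_n] for n | e *)

Section LevelRings.
Variable e : steinitz.

Lemma ev_zeta_lift d n (p : {poly int}) : (0 < n)%N -> (d %| n)%N ->
  exists q, ev_zeta n q = ev_zeta d p.
Proof.
move=> n0 dn; have d0 := dvdn_gt0 n0 dn.
have /(prim_rootP (zeta_prim n0))[i zi] := expr1_dvdn dn (prim_expr_order (zeta_prim d0)).
exists (p \Po 'X^i).
rewrite /ev_zeta map_comp_poly map_polyXn horner_comp hornerXn.
by rewrite zi.
Qed.

Lemma unity_root_ev_zeta n z : (0 < n)%N -> z ^+ n = 1 -> exists p, ev_zeta n p = z.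
Proof.
by move=> n0 /(prim_rootP (zeta_prim n0))[i ->]; exists 'X^i; rewrite ev_zetaXn.
Qed.

Lemma ev_zeta_Zmu n (p : {poly int}) : st_dvd n e -> Zmu e (ev_zeta n p).
Proof.
move=> en; exists [seq (p`_i, nseq i (zeta n)) | i <- iota 0 (size p)]; split.
  move=> q z /mapP[i _ ->] /= /nseqP[-> _]; exists n; split=> //.
  by apply: zeta_prim; case: en.
rewrite ev_zetaE big_map -(big_mkord xpredT (fun i => (p`_i)%:~R * zeta n ^+ i)) /index_iota subn0.
apply: eq_bigr => i _ /=; congr (_ * _).
by elim: i => [|i IH] /=; rewrite ?big_nil // big_cons -IH exprS.
Qed.

(** Phrased with levels instead of [Zmu], since [Zmu_ev_zeta] rests on it; the common level is the
    lcm. *)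
Lemma ev_zeta_level2 u v :
  (exists n, st_dvd n e /\ exists p, u = ev_zeta n p) ->
  (exists n, st_dvd n e /\ exists p, v = ev_zeta n p) ->
  exists n, st_dvd n e /\ (exists p, u = ev_zeta n p) /\ (exists p, v = ev_zeta n p).
Proof.
move=> [m [em [p ->]]] [n [en [q ->]]]; have el := st_dvd_lcmn em en.
exists (lcmn m n); split=> //.
have [p' <-] := ev_zeta_lift p el.1 (dvdn_lcml m n).
have [q' <-] := ev_zeta_lift q el.1 (dvdn_lcmr m n).
by split; [exists p' | exists q'].
Qed.

(** The numbers that have a level contain the integers and mu_e and are closed under sums and
    products. *)
Lemma Zmu_ev_zeta u : Zmu e u -> exists n, st_dvd n e /\ exists p, u = ev_zeta n p.
Proof.
pose lev u := exists n, st_dvd n e /\ exists p, u = ev_zeta n p.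
have levD v w : lev v -> lev w -> lev (v + w).
  move=> lv lw; have [n [en [[p ->] [q ->]]]] := ev_zeta_level2 lv lw.
  by exists n; split=> //; exists (p + q); rewrite rmorphD.
have levM v w : lev v -> lev w -> lev (v * w).
  move=> lv lw; have [n [en [[p ->] [q ->]]]] := ev_zeta_level2 lv lw.
  by exists n; split=> //; exists (p * q); rewrite rmorphM.
have levz c : lev c%:~R.
  by exists 1%N; split; [exact: st_dvd1 | exists c%:~R; rewrite rmorph_int].
move=> [s [hs ->]]; elim: s hs => [|[c l] s IH] hs; first by rewrite big_nil; exact: (levz 0).
rewrite big_cons; apply: (levD); last by apply: IH => p z ps; apply: hs; rewrite inE ps orbT.
apply: (levM) => //=.
have hl0 z : z \in l -> mu e z by apply: (hs (c, l)); rewrite inE eqxx.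
elim: l {hs} hl0 => [|z l IHl] hl; first by rewrite big_nil; exact: (levz 1).
rewrite big_cons; apply: (levM); last by apply: IHl => w wl; apply: hl; rewrite inE wl orbT.
have /muP[n en zn] := hl z (mem_head _ _).
by exists n; split=> //; have [p <-] := unity_root_ev_zeta en.1 zn; exists p.
Qed.

Lemma ZmuP u : Zmu e u <-> exists n, st_dvd n e /\ exists p, u = ev_zeta n p.
Proof. by split=> [/Zmu_ev_zeta //|[n [en [p ->]]]]; exact: ev_zeta_Zmu. Qed.

Lemma Zmu_level2 u v : Zmu e u -> Zmu e v -> exists n, st_dvd n e /\
   (exists p, u = ev_zeta n p) /\ (exists p, v = ev_zeta n p).
Proof. by move=> /ZmuP hu /ZmuP hv; exact: ev_zeta_level2. Qed.

Lemma ZmuD u v : Zmu e u -> Zmu e v -> Zmu e (u + v).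
Proof.
move=> hu hv; have [n [en [[p ->] [q ->]]]] := Zmu_level2 hu hv.
by rewrite -rmorphD; exact: ev_zeta_Zmu.
Qed.

Lemma ZmuM u v : Zmu e u -> Zmu e v -> Zmu e (u * v).
Proof.
move=> hu hv; have [n [en [[p ->] [q ->]]]] := Zmu_level2 hu hv.
by rewrite -rmorphM; exact: ev_zeta_Zmu.
Qed.

Lemma ZmuN u : Zmu e u -> Zmu e (- u).
Proof. by move=> /ZmuP[n [en [p ->]]]; rewrite -rmorphN; exact: ev_zeta_Zmu. Qed.

Lemma Zmuz c : Zmu e c%:~R.
Proof. by rewrite -(rmorph_int (ev_zeta 1)); apply: ev_zeta_Zmu; exact: st_dvd1. Qed.

Lemma Zmu1 : Zmu e 1. Proof. exact: (Zmuz 1). Qed.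

Lemma Zmu_mu z : mu e z -> Zmu e z.
Proof.
move=> /muP[n en zn]; have [p <-] := unity_root_ev_zeta en.1 zn.
exact: ev_zeta_Zmu.
Qed.

End LevelRings.

(* The coordinates of u in the basis zeta^i, i < totient n, of Z[zeta n]; 0 when u is
   not in Z[zeta n]. *)
Definition cyclo_coord (n : nat) (u : algC) : {poly int} :=
  if pselect (exists p, ev_zeta n p = u) is left h
  then Pdiv.Ring.rmodp (projT1 (cid h)) (Cyclotomic n) else 0.

Lemma cyclo_coord_size n u : (size (cyclo_coord n u) <= totient n)%N.
Proof.
rewrite /cyclo_coord; case: pselect => [h|_]; last by rewrite size_poly0.
by rewrite -ltnS -size_Cyclotomic Pdiv.Ring.ltn_rmodp monic_neq0 // Cyclotomic_monic.
Qed.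

Lemma cyclo_coordK n p : (0 < n)%N -> ev_zeta n (cyclo_coord n (ev_zeta n p)) = ev_zeta n p.
Proof.
move=> n0; rewrite /cyclo_coord; case: pselect => [h|[]]; last by exists p.
case: cid => q /= qp; rewrite -qp.
rewrite {2}[q](Pdiv.RingMonic.rdivp_eq (Cyclotomic_monic n)) rmorphD rmorphM /=.
by rewrite ev_zeta_Cyclotomic // mulr0 add0r.
Qed.

Lemma cyclo_coordP n (p : {poly int}) : (0 < n)%N -> (size p <= totient n)%N ->
  cyclo_coord n (ev_zeta n p) = p.
Proof.
move=> n0 sp; apply/eqP; rewrite -subr_eq0; apply/eqP/(@ev_zeta_inj n) => //.
  rewrite (leq_trans (size_polyD _ _)) // size_polyN geq_max sp andbT.
  exact: cyclo_coord_size.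
by rewrite rmorphB /= cyclo_coordK // subrr.
Qed.

Lemma cyclo_coordD n p q : (0 < n)%N ->
  cyclo_coord n (ev_zeta n p + ev_zeta n q) =
  cyclo_coord n (ev_zeta n p) + cyclo_coord n (ev_zeta n q).
Proof.
move=> n0; rewrite -(@cyclo_coordP n (_ + _)) //; last first.
  by rewrite (leq_trans (size_polyD _ _)) // geq_max !cyclo_coord_size.
by rewrite rmorphD /= !cyclo_coordK.
Qed.

Lemma cyclo_coord1 n : (0 < n)%N -> cyclo_coord n 1 = 1.
Proof.
move=> n0; rewrite -(rmorph1 (ev_zeta n)) cyclo_coordP // size_poly1.
by rewrite totient_gt0.
Qed.

(** * The tensor product R' *)

(** A subgroup as a type of its own: the universal property of R' ranges over group types, and
    [tensor_ind] applies it to a subgroup of R'. *)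
Record zsub (V : zmodType) (S : zmodClosed V) := ZSub { zsub_val : V; _ : zsub_val \in S }.

Section ZSub.
Variables (V : zmodType) (S : zmodClosed V).
HB.instance Definition _ := [isSub for @zsub_val V S].
HB.instance Definition _ := [Choice of zsub S by <:].
HB.instance Definition _ := [SubChoice_isSubZmodule of zsub S by <:].
End ZSub.

Section AdditiveMap.
Variables (V W : zmodType) (f : V -> W).
Hypothesis fD : forall x y, f (x + y) = f x + f y.

Lemma addmap0 : f 0 = 0.
Proof. by apply: (addrI (f 0)); rewrite -fD !addr0. Qed.

Lemma addmapN x : f (- x) = - f x.
Proof. by apply: (addrI (f x)); rewrite -fD !subrr addmap0. Qed.

Lemma addmap_sum (I : Type) (s : seq I) (P : pred I) (F : I -> V) :
  f (\sum_(i <- s | P i) F i) = \sum_(i <- s | P i) f (F i).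
Proof. exact: (big_morph f fD addmap0). Qed.

End AdditiveMap.

Section EventuallyZero.
Variables (e : steinitz) (V : zmodType).

(** The first index is a level n, the second a coordinate. These families form a subgroup because
    two thresholds have an lcm that divides e. *)
Definition eventually_zero (f : nat -> nat -> V) : Prop :=
  exists2 d, st_dvd d e &
    forall n, st_dvd n e -> (d %| n)%N -> forall i, f n i = 0.

Definition ezero_pred : {pred nat -> nat -> V} := fun f => `[< eventually_zero f >].

Fact ezero_closed : zmod_closed ezero_pred.
Proof.
split=> [|f g /asboolP[c ec hf] /asboolP[d ed hg]]; apply/asboolP.
  by exists 1%N; [exact: st_dvd1 |].
exists (lcmn c d) => [|n en ln i]; first exact: st_dvd_lcmn.
have := hf n en (dvdn_trans (dvdn_lcml c d) ln) i.
have := hg n en (dvdn_trans (dvdn_lcmr c d) ln) i.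
by rewrite -[(f - g) n i]/(f n i - g n i) => -> ->; rewrite subrr.
Qed.
HB.instance Definition _ :=
  GRing.isZmodClosed.Build (nat -> nat -> V) ezero_pred ezero_closed.

End EventuallyZero.

Section TensorTheory.
Local Open Scope quotient_scope.
Variables (e : steinitz) (k : comPzRingType) (R : algType k) (R' : pzRingType).
Variables (iR : {rmorphism R -> R'}) (iZ : algC -> R').
Hypothesis hT : is_tensor_Zmu e iR iZ.

Lemma iZ1 : iZ 1 = 1. Proof. by case: hT. Qed.

Lemma iZD u v : Zmu e u -> Zmu e v -> iZ (u + v) = iZ u + iZ v.
Proof. by case: hT => _ h _ _ _; exact: h. Qed.

Lemma iZM u v : Zmu e u -> Zmu e v -> iZ (u * v) = iZ u * iZ v.
Proof. by case: hT => _ _ h _ _; exact: h. Qed.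

Lemma iZ0 : iZ 0 = 0.
Proof.
have Z0 := Zmuz e 0; apply: (addrI (iZ 0)).
by rewrite -iZD // !addr0.
Qed.

Lemma iZN u : Zmu e u -> iZ (- u) = - iZ u.
Proof.
by move=> hu; apply: (addrI (iZ u)); rewrite -iZD ?subrr ?iZ0 //; exact: ZmuN.
Qed.

Lemma iZB u v : Zmu e u -> Zmu e v -> iZ (u - v) = iZ u - iZ v.
Proof. by move=> hu hv; rewrite iZD ?iZN //; exact: ZmuN. Qed.

Lemma Zmu_sum (I : Type) (s : seq I) (P : pred I) (F : I -> algC) :
  (forall i, P i -> Zmu e (F i)) -> Zmu e (\sum_(i <- s | P i) F i).
Proof. by move=> hF; elim/big_ind: _ => //; [exact: (Zmuz e 0) | exact: ZmuD]. Qed.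

Lemma iZ_sum (I : Type) (s : seq I) (P : pred I) (F : I -> algC) :
  (forall i, P i -> Zmu e (F i)) ->
  iZ (\sum_(i <- s | P i) F i) = \sum_(i <- s | P i) iZ (F i).
Proof.
move=> hF; elim: s => [|i s IH]; first by rewrite !big_nil iZ0.
rewrite !big_cons; case: ifP => // Pi; rewrite iZD ?IH //; first exact: hF.
exact: Zmu_sum.
Qed.

Lemma iZ_nat n : iZ n%:R = n%:R.
Proof.
elim: n => [|n IH]; first exact: iZ0.
by rewrite !mulrS iZD ?iZ1 ?IH //; [exact: (Zmu1 e) | exact: (Zmuz e n)].
Qed.

Lemma iZ_int c : iZ c%:~R = c%:~R.
Proof.
case: c => n; first by rewrite iZ_nat.
by rewrite NegzE !rmorphN /= iZN ?iZ_nat //; exact: (Zmuz e n.+1).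
Qed.

(* The universal property maps R' onto the subgroup where P holds, and uniqueness
   identifies this map with the identity of R'. *)
Lemma tensor_ind (P : R' -> Prop) :
  P 0 -> (forall x y, P x -> P y -> P (x - y)) ->
  (forall r u, Zmu e u -> P (iR r * iZ u)) -> forall x, P x.
Proof.
move=> P0 PB PT.
have Pc : zmod_closed (fun x => `[< P x >] : bool).
  by split=> [|x y /asboolP hx /asboolP hy]; apply/asboolP; [|exact: PB].
pose S := HB.pack_for (zmodClosed R') ((fun x => `[< P x >]) : {pred R'})
   (GRing.isZmodClosed.Build _ ((fun x => `[< P x >]) : {pred R'}) Pc).
have SP r u : Zmu e u -> iR r * iZ u \in S by move=> hu; apply/asboolP; exact: PT.
pose f r u : zsub S := if pselect (Zmu e u) is left h then ZSub (SP r u h) else 0.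
have vf r u : Zmu e u -> val (f r u) = iR r * iZ u.
  by move=> hu; rewrite /f; case: pselect.
case: hT => _ _ _ _ /(_ (zsub S) f) h.
have [||[g [gD gE]] _] := h.
- by move=> u hu r s; apply: val_inj; rewrite raddfD /= !vf // rmorphD mulrDl.
- move=> r u v hu hv; apply: val_inj; rewrite raddfD /= !vf //; last exact: ZmuD.
  by rewrite iZD // mulrDr.
move=> x; have -> : x = val (g x).
  case: hT => _ _ _ _ /(_ R' (fun r u => iR r * iZ u)) h'.
  have [||_] := h'.
  - by move=> u hu r s; rewrite rmorphD mulrDl.
  - by move=> r u v hu hv; rewrite iZD // mulrDr.
  move=> /(_ id (val \o g)); apply=> //.
    by move=> y z; rewrite /comp gD; exact: (raddfD (val : zsub S -> R')).
  by move=> r u hu /=; rewrite gE // vf.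
by case: (g x) => y /= /asboolP.
Qed.

Lemma tensor_extend (M : zmodType) (f : R -> algC -> M) :
  (forall u, Zmu e u -> forall r s, f (r + s) u = f r u + f s u) ->
  (forall r u v, Zmu e u -> Zmu e v -> f r (u + v) = f r u + f r v) ->
  exists g : R' -> M, (forall x y, g (x + y) = g x + g y) /\
            forall r u, Zmu e u -> g (iR r * iZ u) = f r u.
Proof. by move=> h1 h2; case: hT => _ _ _ _ /(_ M f h1 h2)[]. Qed.

Lemma iZ_ev_zeta n N (p : {poly int}) : st_dvd n e -> (size p <= N)%N ->
  iZ (ev_zeta n p) = \sum_(i < N) (p`_i)%:~R * iZ (zeta n ^+ i).
Proof.
move=> en sp.
have Zz i : Zmu e (zeta n ^+ i) by rewrite -ev_zetaXn; exact: ev_zeta_Zmu.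
rewrite ev_zetaE iZ_sum; last by move=> i _; apply: ZmuM => //; exact: Zmuz.
transitivity (\sum_(i < size p) (p`_i)%:~R * iZ (zeta n ^+ i)).
  by apply: eq_bigr => i _; rewrite iZM ?iZ_int //; exact: Zmuz.
rewrite (big_ord_widen N (fun i => (p`_i)%:~R * iZ (zeta n ^+ i))) // big_mkcond /=.
by apply: eq_bigr => i _; case: ltnP => // h; rewrite nth_default // mul0r.
Qed.

(** Expand u in powers of some [zeta n] and move the integer coefficients into R. *)
Lemma tensor_mu_rep x : exists s : seq (R * algC),
  (forall p, p \in s -> mu e p.2) /\ x = \sum_(p <- s) iR p.1 * iZ p.2.
Proof.
elim/tensor_ind: x => [|x y [s [hs ->]] [t [ht ->]]|r u].
- by exists [::]; rewrite big_nil.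
- exists (s ++ [seq (- p.1, p.2) | p <- t]); split=> [p|].
    by rewrite mem_cat => /orP[/hs //|/mapP[q /ht hq ->]].
  rewrite big_cat big_map /= -sumrN; congr (_ + _).
  by apply: eq_bigr => p _; rewrite rmorphN mulNr.
move=> /ZmuP[n [en [p ->]]].
exists [seq (r *~ p`_i, zeta n ^+ i) | i <- iota 0 (size p)]; split.
  by move=> q /mapP[i _ ->] /=; apply: muX; exists n; split=> //; apply: zeta_prim; case: en.
rewrite (iZ_ev_zeta en (leqnn _)) big_map mulr_sumr /=.
rewrite -(big_mkord xpredT (fun i => iR r * ((p`_i)%:~R * iZ (zeta n ^+ i)))) /index_iota subn0.
by apply: eq_bigr => i _; rewrite mulrA mulrzr rmorphMz.
Qed.

Lemma tensor_mu_ind (P : R' -> Prop) :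
  P 0 -> (forall x y, P x -> P y -> P (x + y)) ->
  (forall r z, mu e z -> P (iR r * iZ z)) -> forall x, P x.
Proof.
move=> P0 PD PT x; have [s [hs ->]] := tensor_mu_rep x.
by rewrite big_seq; elim/big_ind: _ => // p /hs; exact: PT.
Qed.

(* The maps r (x) u |-> r *~ coordinates of u in Z[zeta n] are compatible with sums only
   for the n such that Z[zeta n] contains the scalars involved, hence the target is
   taken modulo the families that vanish for all sufficiently divisible n. *)
Lemma tensor_eq0_coord (s : seq (R * algC)) :
  (forall p, p \in s -> Zmu e p.2) -> \sum_(p <- s) iR p.1 * iZ p.2 = 0 ->
  exists2 d, st_dvd d e & forall n, st_dvd n e -> (d %| n)%N ->
    forall i, \sum_(p <- s) p.1 *~ (cyclo_coord n p.2)`_i = 0.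
Proof.
move=> hs s0.
pose F := nat -> nat -> R.
pose I : zmodClosed F := @ezero_pred e R.
pose cs r u : F := fun n i => r *~ (cyclo_coord n u)`_i.
pose Q := Quotient.quot I.
have piD (f g : F) : \pi_Q (f + g) = \pi_Q f + \pi_Q g by exact: raddfD.
pose f r u : Q := \pi_Q (cs r u).
have [||g [gD gE]] := @tensor_extend Q f.
- move=> u hu r s'; rewrite /f -piD; congr (\pi_Q _).
  by apply/funext => n; apply/funext => i; rewrite /cs mulrzDl.
- move=> r u v hu hv; rewrite /f -piD; apply/eqP; rewrite -Quotient.idealrBE.
  have [d [ed [[p Ep] [q Eq]]]] := Zmu_level2 hu hv.
  apply/asboolP; exists d => // n en dn i.
  have [p' Ep'] := ev_zeta_lift p en.1 dn; have [q' Eq'] := ev_zeta_lift q en.1 dn.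
  rewrite Ep Eq -Ep' -Eq'.
  rewrite -[LHS]/(cs r _ n i - (cs r _ n i + cs r _ n i)) /cs.
  by rewrite cyclo_coordD ?coefD ?mulrzDr ?subrr //; case: en.
have : g (\sum_(p <- s) iR p.1 * iZ p.2) = \pi_Q (\sum_(p <- s) cs p.1 p.2).
  rewrite (addmap_sum gD) (addmap_sum piD) !big_seq.
  by apply: eq_bigr => p /hs hp; exact: gE.
rewrite s0 (addmap0 gD) -(addmap0 piD) => /esym/eqP.
rewrite -Quotient.idealrBE subr0 => h0; have [d ed h] : eventually_zero e (\sum_(p <- s) cs p.1 p.2) by apply/asboolP; exact: h0.
exists d => // n en dn i.
by have := h n en dn i; rewrite fct_sumE /= fct_sumE.
Qed.

(** After expansion in the basis [zeta n ^+ i], i < totient n, the coefficient of each basis element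
    is the image under [iR] of a vanishing sum. *)
Lemma coord_eq0_tensor n (s : seq (R * algC)) : st_dvd n e ->
  (forall p, p \in s -> exists q, p.2 = ev_zeta n q) ->
  (forall i, \sum_(p <- s) p.1 *~ (cyclo_coord n p.2)`_i = 0) ->
  \sum_(p <- s) iR p.1 * iZ p.2 = 0.
Proof.
move=> en hs s0.
transitivity (\sum_(p <- s) \sum_(i < totient n)
    iR (p.1 *~ (cyclo_coord n p.2)`_i) * iZ (zeta n ^+ i)).
  rewrite !big_seq; apply: eq_bigr => p /hs[q Eq].
  have n0 := en.1.
  rewrite {1}Eq -(cyclo_coordK q n0) -Eq (iZ_ev_zeta en (cyclo_coord_size n _)).
  by rewrite mulr_sumr; apply: eq_bigr => i _; rewrite mulrA mulrzr rmorphMz.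
rewrite exchange_big big1 // => i _.
by rewrite -mulr_suml -rmorph_sum s0 rmorph0 mul0r.
Qed.

Lemma common_level (s : seq (R * algC)) : (forall p, p \in s -> Zmu e p.2) ->
  exists2 n, st_dvd n e & forall p, p \in s -> exists q, p.2 = ev_zeta n q.
Proof.
elim: s => [|p s IH] hs; first by exists 1%N => //; exact: st_dvd1.
have [|n en hn] := IH; first by move=> q qs; apply: hs; rewrite inE qs orbT.
have /ZmuP[m [em [q Eq]]] := hs p (mem_head _ _).
have el := st_dvd_lcmn em en; exists (lcmn m n) => // t; rewrite inE.
case/orP=> [/eqP->|/hn[q' ->]].
  by rewrite Eq; have [q2 <-] := ev_zeta_lift q el.1 (dvdn_lcml m n); exists q2.
by have [q2 <-] := ev_zeta_lift q' el.1 (dvdn_lcmr m n); exists q2.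
Qed.

(** At every level n > 0 the coordinate polynomial of 1 is the constant 1, so r is itself the
    coordinate of index 0 of r (x) 1. *)
Lemma iR_inj : injective iR.
Proof.
suff h r : iR r = 0 -> r = 0.
  by move=> r s rs; apply/eqP; rewrite -subr_eq0; apply/eqP/h; rewrite rmorphB rs subrr.
move=> r0; have [||d ed /(_ d ed (dvdnn d) 0%N)] := @tensor_eq0_coord [:: (r, 1)].
- by move=> p; rewrite inE => /eqP->; exact: (Zmu1 e).
- by rewrite big_seq1 /= r0 mul0r.
by rewrite big_seq1 /= cyclo_coord1 ?coef1 //; case: ed.
Qed.

Hypothesis hR : forall d : nat, st_dvd d e -> injective (fun r : R => r *+ d).

(** Multiplying x by m multiplies its coordinates by m, which is injective on R. The level used is a
    multiple of the threshold from [tensor_eq0_coord] and of a common level of the terms of x. *)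
Lemma tensor_torsion_free m (x : R') : st_dvd m e -> x *+ m = 0 -> x = 0.
Proof.
move=> em; have [s [hs ->]] := tensor_mu_rep x => xm0.
have hs' p : p \in s -> Zmu e p.2 by move=> /hs; exact: Zmu_mu.
have [|| d ed hd] := @tensor_eq0_coord [seq (p.1 *+ m, p.2) | p <- s].
- by move=> p /mapP[q /hs' hq ->].
- rewrite big_map -[RHS]xm0 -sumrMnl; apply: eq_bigr => p _ /=.
  by rewrite rmorphMn mulrnAl.
have [n en hn] := common_level hs'.
have el := st_dvd_lcmn ed en; apply: (coord_eq0_tensor el) => [p /hn[q ->]|i].
  by have [q2 <-] := ev_zeta_lift q el.1 (dvdn_lcmr d n); exists q2.
apply: (hR em); rewrite mul0rn -[RHS](hd _ el (dvdn_lcml d n) i) big_map -sumrMnl.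
by apply: eq_bigr => p _ /=; rewrite !pmulrn mulrzAC.
Qed.

End TensorTheory.

(** * Galois descent *)

Section CyclotomicCharacter.
Implicit Type nu : {rmorphism algC -> algC}.

(** The cyclotomic character of nu at level n; the default 0 is reached only for [n = 0]. *)
Definition aut_exp nu (n : nat) : nat :=
  if [pick i : 'I_n | nu (zeta n) == zeta n ^+ i] is Some i then i else 0%N.

Lemma aut_expE nu n z : (0 < n)%N -> z ^+ n = 1 -> nu z = z ^+ aut_exp nu n.
Proof.
move=> n0 zn; have zP := zeta_prim n0.
have [i ->] := prim_rootP zP zn; rewrite rmorphXn /= exprAC; congr (_ ^+ i).
rewrite /aut_exp; case: pickP => [j /eqP // | h].
have nuz : nu (zeta n) ^+ n = 1 by rewrite -rmorphXn /= (prim_expr_order zP) rmorph1.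
by have [j hj] := prim_rootP zP nuz; have := h j; rewrite hj eqxx.
Qed.

Lemma aut_exp_lt nu n : (0 < n)%N -> (aut_exp nu n < n)%N.
Proof. by rewrite /aut_exp; case: pickP. Qed.

(** Compatibility: the exponent by which nu acts on [zeta d'] is unique modulo d'. Coprimality: nu
    preserves the order of a root of unity. *)
Lemma aut_exp_zhat_unit e nu : zhat_unit e (aut_exp nu).
Proof.
split; first split=> [d [d0 _]|d d' [d0 _] d'0 d'd]; first exact: aut_exp_lt.
  have zP := zeta_prim d'0; have zd' := prim_expr_order zP.
  have /eqP := aut_expE nu d'0 zd'; rewrite (aut_expE nu d0 (expr1_dvdn d'd zd')).
  by rewrite (eq_prim_root_expr zP) => /eqP->; rewrite modn_small // aut_exp_lt.
move=> d [d0 _]; have zP := zeta_prim d0.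
rewrite -(prim_root_exp_coprime _ zP) -(aut_expE nu d0 (prim_expr_order zP)).
by rewrite fmorph_primitive_root.
Qed.

Lemma Zmu_aut e nu u : Zmu e u -> Zmu e (nu u).
Proof.
move=> /ZmuP[n [en [p ->]]].
suff -> : nu (ev_zeta n p) = ev_zeta n (p \Po 'X^(aut_exp nu n)) by exact: ev_zeta_Zmu.
have n0 := en.1; rewrite /ev_zeta map_comp_poly map_polyXn horner_comp hornerXn.
rewrite -(aut_expE nu n0 (prim_expr_order (zeta_prim n0))) -horner_map -map_poly_comp.
by congr _.[_]; apply: eq_map_poly => b; rewrite /= rmorph_int.
Qed.

Lemma mu_aut e nu z : mu e z -> mu e (nu z).
Proof. by move=> /muP[n en zn]; rewrite (aut_expE nu en.1 zn); apply: muX; apply/muP; exists n. Qed.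

End CyclotomicCharacter.

Lemma sum_unity_root (F : idomainType) n (w : F) : w ^+ n = 1 ->
  \sum_(0 <= j < n) w ^+ j = if w == 1 then n%:R else 0.
Proof.
move=> wn; case: eqP => [->|/eqP w1].
  by rewrite (eq_bigr (fun=> 1)) => [|j _]; rewrite ?expr1n // sumr_const_nat subn0.
have /eqP := subrX1 w n; rewrite wn subrr eq_sym mulf_eq0 subr_eq0 (negPf w1) /=.
by rewrite big_mkord => /eqP.
Qed.

Section GaloisDescent.
Variables (e : steinitz) (k : comPzRingType) (R : algType k) (R' : pzRingType).
Variables (iR : {rmorphism R -> R'}) (iZ : algC -> R').
Hypothesis hT : is_tensor_Zmu e iR iZ.
Implicit Type nu : {rmorphism algC -> algC}.

Lemma iZ_central u x : Zmu e u -> iZ u * x = x * iZ u.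
Proof.
move=> hu; elim/(tensor_ind hT): x => [|x y hx hy|r v hv]; first by rewrite mulr0 mul0r.
  by rewrite mulrBr hx hy mulrBl.
case: (hT) => _ _ _ /(_ r u hu) h _.
by rewrite mulrA -h -!mulrA -!(iZM hT) // mulrC.
Qed.

Lemma tensor_map_ext (f g : R' -> R') :
  (forall x y, f (x + y) = f x + f y) -> (forall x y, g (x + y) = g x + g y) ->
  (forall r z, mu e z -> f (iR r * iZ z) = g (iR r * iZ z)) -> forall x, f x = g x.
Proof.
move=> fD gD h x; elim/(tensor_mu_ind hT): x => [|x y hx hy|r z /h //].
  by rewrite (addmap0 fD) (addmap0 gD).
by rewrite fD hx hy gD.
Qed.

Lemma twist_ex nu : exists T : R' -> R', (forall x y, T (x + y) = T x + T y) /\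
  forall r u, Zmu e u -> T (iR r * iZ u) = iR r * iZ (nu u).
Proof.
apply: (tensor_extend hT (f := fun r u => iR r * iZ (nu u))) => [u _ r s|r u v hu hv].
  by rewrite rmorphD mulrDl.
by rewrite rmorphD /= (iZD hT) ?mulrDr //; exact: Zmu_aut.
Qed.

(** The map id (x) nu, that is, tau_a for the a given by the cyclotomic character of nu
    ([twist_is_tau]). *)
Definition twist nu : R' -> R' := projT1 (cid (twist_ex nu)).

Lemma twistD nu x y : twist nu (x + y) = twist nu x + twist nu y.
Proof. by rewrite /twist; case: cid => T /= []. Qed.

Lemma twistE nu r u : Zmu e u -> twist nu (iR r * iZ u) = iR r * iZ (nu u).
Proof. by rewrite /twist; case: cid => T /= [_ h]; exact: h. Qed.

Lemma twist_iR nu r : twist nu (iR r) = iR r.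
Proof.
by have := twistE nu r (Zmu1 e); rewrite rmorph1 (iZ1 hT) mulr1.
Qed.

Lemma twist_semilinear nu u x : Zmu e u -> twist nu (iZ u * x) = iZ (nu u) * twist nu x.
Proof.
move=> hu; have hnu := Zmu_aut nu hu.
apply: (tensor_map_ext (f := fun x => twist nu (iZ u * x))
  (g := fun x => iZ (nu u) * twist nu x)) => [a b|a b|r z /Zmu_mu hz].
- by rewrite mulrDr twistD.
- by rewrite twistD mulrDr.
rewrite mulrA (iZ_central _ hu) -mulrA -(iZM hT) // !twistE //; last exact: ZmuM.
have hnz := Zmu_aut nu hz; rewrite mulrA (iZ_central _ hnu) -mulrA -(iZM hT) // rmorphM //.
Qed.

Lemma twist_is_tau nu : is_tau e iR iZ (aut_exp nu) (twist nu).
Proof.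
split=> [|r z n zP en]; first exact: twistD.
rewrite twistE; last by apply: Zmu_mu; exists n.
by rewrite (aut_expE nu en.1 (prim_expr_order zP)).
Qed.

Lemma twistK nu nu' : cancel nu' nu -> cancel (twist nu') (twist nu).
Proof.
move=> nuK x; move: x; apply: (tensor_map_ext (f := fun x => twist nu (twist nu' x)) (g := id)).
- by move=> a b; rewrite !twistD.
- by [].
by move=> r z /Zmu_mu hz; rewrite !twistE ?nuK //; exact: Zmu_aut.
Qed.

(** For n | e this is the image of R (x) Z[mu_n] in R'. *)
Definition mu_span (n : nat) (x : R') : Prop := exists2 s : seq (R * algC),
  (forall t, t \in s -> t.2 ^+ n = 1) & x = \sum_(t <- s) iR t.1 * iZ t.2.

Lemma mu_span_ex x : exists2 n, st_dvd n e & mu_span n x.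
Proof.
elim/(tensor_mu_ind hT): x => [|x y [m em [s hs ->]] [n en [t ht ->]]|r z /muP[n en zn]].
- by exists 1%N; [exact: st_dvd1 | exists [::]; rewrite ?big_nil].
- exists (lcmn m n); first exact: st_dvd_lcmn.
  exists (s ++ t) => [q|]; last by rewrite big_cat.
  rewrite mem_cat => /orP[/hs|/ht]; apply: expr1_dvdn; first exact: dvdn_lcml.
  exact: dvdn_lcmr.
exists n => //; exists [:: (r, z)]; last by rewrite big_seq1.
by move=> t; rewrite inE => /eqP->.
Qed.

Lemma mu_span1 x : mu_span 1 x -> exists r, x = iR r.
Proof.
move=> [s hs ->]; exists (\sum_(t <- s) t.1); rewrite rmorph_sum !big_seq.
by apply: eq_bigr => t /hs; rewrite expr1 => ->; rewrite (iZ1 hT) mulr1.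
Qed.

Hypothesis hR : forall d : nat, st_dvd d e -> injective (fun r : R => r *+ d).

(* The automorphisms z |-> z^(1 + d j), for j < p, fix the d-th roots of unity, and
   averaging over them kills the other (p d)-th roots of unity. *)
Lemma mu_span_descent_ramified p d x : prime p -> (p %| d)%N -> st_dvd (p * d) e ->
  (forall nu, twist nu x = x) -> mu_span (p * d) x -> mu_span d x.
Proof.
move=> pp pd epd fx [s hs Ex].
have cop j : coprime (1 + d * j) (p * d).
  rewrite coprimeMr; apply/andP; split.
    by apply: (coprime_dvdr pd); rewrite /coprime addnC mulnC gcdnC gcdnMDl gcdn1.
  by rewrite /coprime addnC mulnC gcdnC gcdnMDl gcdn1.
pose nu j := sval (Qn_aut_exists (cop j)).
have nuE j z : z ^+ (p * d) = 1 -> nu j z = z ^+ (1 + d * j).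
  by rewrite /nu; case: Qn_aut_exists => f /= h; exact: h.
(* The terms at d-th roots of unity are kept. That they sum to x is checked after multiplication by
   p, which is regular on R' since p | e. *)
exists [seq t <- s | t.2 ^+ d == 1] => [t|].
  by rewrite mem_filter => /andP[/eqP].
have ep : st_dvd p e by apply: st_dvd_dvdn epd; exact: dvdn_mulr.
apply/eqP; rewrite -subr_eq0; apply/eqP/(tensor_torsion_free hT hR ep).
rewrite mulrnBl; apply/eqP; rewrite subr_eq0; apply/eqP.
have mus t : t \in s -> mu e t.2 by move=> ts; apply/muP; exists (p * d)%N => //; exact: hs.
transitivity (\sum_(0 <= j < p) twist (nu j) x).
  by rewrite (eq_bigr (fun=> x)) // sumr_const_nat subn0.
rewrite big_filter -sumrMnl [in RHS]big_mkcond /=.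
transitivity (\sum_(0 <= j < p) \sum_(t <- s) iR t.1 * iZ (t.2 ^+ (1 + d * j))).
  apply: eq_bigr => j _; rewrite Ex (addmap_sum (twistD _)) !big_seq.
  by apply: eq_bigr => t ts; rewrite twistE ?nuE //; [exact: hs | apply/Zmu_mu/mus].
rewrite exchange_big /= !big_seq; apply: eq_bigr => t ts.
rewrite -mulr_sumr -(iZ_sum hT); last by move=> j _; apply/Zmu_mu/muX/mus.
(* As [t.2 ^+ d] is a p-th root of unity, the inner sum is p if [t.2 ^+ d = 1] and 0 otherwise. *)
have -> : \sum_(0 <= j < p) t.2 ^+ (1 + d * j) = t.2 * \sum_(0 <= j < p) (t.2 ^+ d) ^+ j.
  by rewrite mulr_sumr; apply: eq_bigr => j _; rewrite exprD expr1 exprM.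
rewrite sum_unity_root; last by rewrite -exprM mulnC hs.
case: eqP => _; last by rewrite mulr0 (iZ0 hT) mulr0.
rewrite (iZM hT) ?(iZ_nat hT) ?mulr_natr ?mulrnAr //; first exact/Zmu_mu/mus.
exact: (Zmuz e p).
Qed.

(* With c = (1 mod d, 0 mod p) and c' = (0 mod d, 1 mod p), the automorphisms
   z |-> z^(c + c' j), for 0 < j < p, fix the d-th roots of unity and act as j on
   the p-th ones; summing them against w^-j for w of order p multiplies x by -1. *)
Lemma mu_span_descent_unramified p d x : prime p -> coprime d p -> st_dvd (p * d) e ->
  (forall nu, twist nu x = x) -> mu_span (p * d) x -> mu_span d x.
Proof.
move=> pp dp epd fx [s hs Ex].
have p0 := prime_gt0 pp; have d0 : (0 < d)%N by case: epd; rewrite muln_gt0 => /andP[].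
have [c cd cp] : exists2 c, c = 1 %[mod d] & (p %| c)%N.
  by exists (chinese d p 1 0); rewrite /dvdn ?chinese_modl ?chinese_modr // mod0n.
have [c' c'd c'p] : exists2 c', (d %| c')%N & c' = 1 %[mod p].
  by exists (chinese d p 0 1); rewrite /dvdn ?chinese_modl ?chinese_modr // mod0n.
(* Outside 0 < j < p the identity is a dummy value, so that [choice] yields a function on all of
   [nat]. *)
have cop j : exists nu : {rmorphism algC -> algC}, (0 < j < p)%N ->
    forall z, z ^+ (p * d) = 1 -> nu z = z ^+ (c + c' * j).
  case: (boolP (0 < j < p)%N) => [/andP[j0 jp]|_]; last by exists idfun.
  have cj : coprime (c + c' * j) (p * d).
    rewrite coprimeMr; apply/andP; split; rewrite -coprime_modl.
      case/dvdnP: cp => a ->; rewrite modnMDl -modnMml c'p modnMml mul1n.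
      by rewrite modn_small // coprime_sym prime_coprime // gtnNdvd.
    case/dvdnP: c'd => a ->; rewrite mulnAC addnC modnMDl cd.
    by rewrite coprime_modl coprime1n.
  by have [nu h] := Qn_aut_exists cj; exists nu.
have [nu nuE] := choice cop.
pose w := zeta p; have wP := zeta_prim p0.
have wp : w^-1 ^+ p = 1 by rewrite exprVn (prim_expr_order wP) invr1.
have muw j : mu e (w^-1 ^+ j).
  by apply: muX; apply/muP; exists p => //; apply: st_dvd_dvdn epd; exact: dvdn_mulr.
have w1 : w^-1 != 1.
  apply: contraTneq (prime_gt1 pp) => h; rewrite -leqNgt dvdn_leq //.
  by rewrite (prim_order_dvd wP) expr1 -[zeta p]invrK h invr1.
have sum1p (v : algC) : v ^+ p = 1 ->
    \sum_(1 <= j < p) v ^+ j = (if v == 1 then p%:Z else 0)%:~R - 1.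
  move=> /sum_unity_root; rewrite big_ltn // expr0 => h.
  by apply: (addrI 1); rewrite h addrC subrK; case: ifP.
(* For z a (p d)-th root of unity, [W z] is a p-th root of unity and [m z] is the sum of its powers
   with exponents 0 < j < p. *)
pose W z := w^-1 * z ^+ c'.
pose m z : int := (if W z == 1 then p%:Z else 0) - 1.
have mus t : t \in s -> mu e t.2 by move=> ts; apply/muP; exists (p * d)%N => //; exact: hs.
(* Since p | c, [t.2 ^+ c] is a d-th root of unity. The sign of the coefficients comes from the sum
   of the [w^-1 ^+ j] over 0 < j < p being -1. *)
exists [seq (t.1 *~ - m t.2, t.2 ^+ c) | t <- s] => [t /mapP[q qs ->] /=|].
  by rewrite -exprM; apply: expr1_dvdn (hs _ qs); exact: dvdn_mul.
apply: oppr_inj.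
transitivity (\sum_(1 <= j < p) iZ (w^-1 ^+ j) * twist (nu j) x).
  rewrite (eq_bigr (fun j => iZ (w^-1 ^+ j) * x)) => [|j _]; last by rewrite fx.
  rewrite -mulr_suml -(iZ_sum hT) => [|j _]; last exact/Zmu_mu.
  rewrite sum1p // (negPf w1) sub0r (iZN hT) ?(iZ1 hT) ?mulN1r //; exact: (Zmu1 e).
transitivity (\sum_(1 <= j < p) \sum_(t <- s)
    iR t.1 * iZ (w^-1 ^+ j * t.2 ^+ (c + c' * j))).
  rewrite !big_nat; apply: eq_bigr => j hj; rewrite Ex (addmap_sum (twistD _)) mulr_sumr.
  rewrite !big_seq; apply: eq_bigr => t ts.
  have hwj := Zmu_mu (muw j); have htj := Zmu_mu (muX (c + c' * j) (mus t ts)).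
  rewrite twistE; last exact/Zmu_mu/mus.
  by rewrite (nuE j hj) ?hs // mulrA (iZ_central _ hwj) -mulrA -(iZM hT) // mulrC.
rewrite exchange_big /= big_map -sumrN !big_seq; apply: eq_bigr => t ts.
have ht := mus t ts.
rewrite -mulr_sumr -(iZ_sum hT); last first.
  by move=> j _; apply/Zmu_mu/muM; [exact: muw | exact: muX].
have -> : \sum_(1 <= j < p) w^-1 ^+ j * t.2 ^+ (c + c' * j) = (m t.2)%:~R * t.2 ^+ c.
  rewrite /m rmorphB /= -sum1p; last first.
    rewrite exprMn wp mul1r -exprM; apply: expr1_dvdn (hs t ts).
    by rewrite mulnC dvdn_mul.
  rewrite mulr_suml; apply: eq_bigr => j _.
  by rewrite exprD exprM /W exprMn -!mulrA; congr (_ * _); rewrite mulrC.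
rewrite (iZM hT) ?(iZ_int hT) //; [|exact: Zmuz|exact/Zmu_mu/muX].
by rewrite mulrA mulrzr rmorphMz mulrNz mulNr opprK.
Qed.

(** Strong induction on the level n of x: a prime p is split off from n = p d, with two cases
    according to whether p | d, until level 1 is reached. *)
Lemma twist_fixed x : (forall nu, twist nu x = x) -> exists r, x = iR r.
Proof.
move=> fx; have [n en xn] := mu_span_ex x; apply: mu_span1.
elim/ltn_ind: n en xn => n IH en xn.
have [n1|n1] := leqP n 1; first by have -> : 1%N = n by apply/eqP; rewrite eqn_leq n1 en.1.
have [p pp /dvdnP[d En]] := pdivP n1; rewrite mulnC in En; subst n.
have ed : st_dvd d e := st_dvd_dvdn (dvdn_mull p (dvdnn d)) en.
apply: (IH d _ ed); first by rewrite ltn_Pmull ?prime_gt1 //; case: ed.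
have [pd|pd] := boolP (p %| d)%N; first exact: mu_span_descent_ramified xn.
by apply: mu_span_descent_unramified xn => //; rewrite coprime_sym prime_coprime.
Qed.

End GaloisDescent.

(** * Gradings from automorphisms *)

Section MuDecomposition.
Variables (e : steinitz) (V : zmodType) (E : algC -> V -> Prop).

(** [E] stays abstract to cover the pieces of a grading of R, the eigenspaces in R' and the
    subgroups R_z (x) Z[mu_e]. *)
Definition mu_decomp (x : V) (s : seq algC) (g : algC -> V) : Prop :=
  [/\ uniq s, (forall z, z \in s -> mu e z),
      (forall z, z \in s -> E z (g z)) & x = \sum_(z <- s) g z].

Definition mu_indep : Prop :=
  forall (s : seq algC) (g : algC -> V), uniq s -> (forall z, z \in s -> mu e z) ->
    (forall z, z \in s -> E z (g z)) -> \sum_(z <- s) g z = 0 ->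
    forall z, z \in s -> g z = 0.

(** The component at z of a decomposition, whether or not z is listed; decompositions with different
    supports can then be compared. *)
Definition extend0 (s : seq algC) (g : algC -> V) (z : algC) : V :=
  if z \in s then g z else 0.

Lemma sum_extend0 (W : zmodType) (phi : algC -> V -> W) s t g :
  (forall z, phi z 0 = 0) -> uniq s -> uniq t -> {subset s <= t} ->
  \sum_(z <- s) phi z (g z) = \sum_(z <- t) phi z (extend0 s g z).
Proof.
move=> phi0 us ut st.
transitivity (\sum_(z <- t | z \in s) phi z (g z)).
  rewrite -[RHS]big_filter; apply: perm_big; apply: uniq_perm => //.
    exact: filter_uniq.
  by move=> z; rewrite mem_filter andbC; case zs: (z \in s); rewrite ?(st z zs) ?andbF.
by rewrite big_mkcond; apply: eq_bigr => z _; rewrite /extend0; case: ifP.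
Qed.

Hypothesis E0 : forall z, mu e z -> E z 0.
Hypothesis ED : forall z x y, mu e z -> E z x -> E z y -> E z (x + y).

Lemma extend0_in s g z : (forall w, w \in s -> E w (g w)) -> mu e z -> E z (extend0 s g z).
Proof. by move=> hg hz; rewrite /extend0; case: ifP => [/hg //|_]; exact: E0. Qed.

Lemma mu_decompD x y s g t h : mu_decomp x s g -> mu_decomp y t h ->
  mu_decomp (x + y) (undup (s ++ t)) (fun z => extend0 s g z + extend0 t h z).
Proof.
move=> [us ms gE ->] [ut mt hE ->].
have mst z : z \in undup (s ++ t) -> mu e z.
  by rewrite mem_undup mem_cat => /orP[/ms|/mt].
split=> // [|z zst|]; first exact: undup_uniq.
  by apply: ED; [exact: mst | apply: extend0_in; auto..].
rewrite big_split /=; congr (_ + _).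
  apply: (@sum_extend0 V (fun _ x => x)); rewrite ?undup_uniq //.
  by move=> z zs; rewrite mem_undup mem_cat zs.
apply: (@sum_extend0 V (fun _ x => x)); rewrite ?undup_uniq //.
by move=> z zs; rewrite mem_undup mem_cat zs orbT.
Qed.

Hypothesis EN : forall z x, mu e z -> E z x -> E z (- x).
Hypothesis indep : mu_indep.

(** The difference of the two decompositions is a decomposition of 0 over the union of the supports,
    to which independence applies. *)
Lemma mu_decomp_uniq x s g t h z : mu_decomp x s g -> mu_decomp x t h ->
  extend0 s g z = extend0 t h z.
Proof.
move=> Ds [ut mt hE Ex].
have DN : mu_decomp (- x) t (fun z => - h z).
  split=> // [w wt|]; last by rewrite Ex sumrN.
  by apply: EN; [exact: mt | exact: hE].
have [us ms gE D0] := mu_decompD Ds DN; rewrite subrr in D0.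
have := indep us ms gE (esym D0) (z := z); rewrite mem_undup mem_cat /extend0.
case zs: (z \in s) => /=; case zt: (z \in t) => //= /(_ isT) /eqP.
- by rewrite subr_eq0 => /eqP.
- by rewrite addr0 => /eqP.
- by rewrite add0r oppr_eq0 => /eqP.
Qed.

(** This makes a map defined through a chosen decomposition independent of the choice, as
    [graded_map_ex] requires. *)
Lemma sum_mu_decomp_uniq (W : zmodType) (phi : algC -> V -> W) x s g t h :
  (forall z, phi z 0 = 0) -> mu_decomp x s g -> mu_decomp x t h ->
  \sum_(z <- s) phi z (g z) = \sum_(z <- t) phi z (h z).
Proof.
move=> phi0 Ds Dt; have [us _ _ _] := Ds; have [ut _ _ _] := Dt.
rewrite (@sum_extend0 _ phi s (undup (s ++ t))) ?undup_uniq //; last first.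
  by move=> z zs; rewrite mem_undup mem_cat zs.
rewrite (@sum_extend0 _ phi t (undup (s ++ t))) ?undup_uniq //; last first.
  by move=> z zs; rewrite mem_undup mem_cat zs orbT.
by apply: eq_bigr => z _; rewrite (mu_decomp_uniq z Ds Dt).
Qed.

Lemma mu_decomp1 z x : mu e z -> E z x -> mu_decomp x [:: z] (fun=> x).
Proof.
by move=> hz hx; split; rewrite ?big_seq1 // => w; rewrite inE => /eqP->.
Qed.

Lemma mu_decomp_hom z x s g : mu e z -> E z x -> mu_decomp x s g -> x = extend0 s g z.
Proof.
move=> hz hx Ds; rewrite (mu_decomp_uniq z Ds (mu_decomp1 hz hx)).
by rewrite /extend0 inE eqxx.
Qed.

End MuDecomposition.

(** * Independence of eigenvectors and the grading attached to an element of X_e *)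

Section Correspondence.
Variables (e : steinitz) (k : comPzRingType) (R : algType k) (R' : pzRingType).
Variables (iR : {rmorphism R -> R'}) (iZ : algC -> R').
Hypothesis hT : is_tensor_Zmu e iR iZ.

Lemma tensorM r u s v : Zmu e u -> Zmu e v ->
  (iR r * iZ u) * (iR s * iZ v) = iR (r * s) * iZ (u * v).
Proof.
move=> hu hv; rewrite rmorphM (iZM hT) // -!mulrA; congr (_ * _).
by rewrite mulrA (iZ_central hT _ hu) -mulrA.
Qed.

Lemma kp_linearZ f u x : kp_linear e iR iZ f -> Zmu e u -> f (iZ u * x) = iZ u * f x.
Proof.
by move=> [_ fZ] hu; have := fZ 1 u x hu; rewrite scale1r rmorph1 !mul1r.
Qed.

Section EigenSpaces.
Variable f : R' -> R'.
Hypothesis fD : forall x y, f (x + y) = f x + f y.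

Lemma eigen0 z : eigen iZ f z 0.
Proof. by rewrite /eigen (addmap0 fD) mulr0. Qed.

Lemma eigenD z x y : eigen iZ f z x -> eigen iZ f z y -> eigen iZ f z (x + y).
Proof. by rewrite /eigen fD mulrDr => -> ->. Qed.

Lemma eigenN z x : eigen iZ f z x -> eigen iZ f z (- x).
Proof. by rewrite /eigen (addmapN fD) mulrN => ->. Qed.

End EigenSpaces.

(* If eta = z / w has eta^n = 1, then n = sum_(i < n) (1 - eta^i), and 1 - eta divides
   every summand. *)
Lemma sub_unity_root_dvd z w : mu e z -> mu e w -> z != w ->
  exists v n, [/\ Zmu e v, st_dvd n e & (z - w) * v = n%:R].
Proof.
move=> hz hw zw; have w0 := mu_neq0 hw.
have heta : mu e (z / w) by apply: muM => //; exact: muV.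
set eta := z / w in heta.
have eta1 : eta != 1.
  by apply: contra zw => /eqP h; rewrite -[z](divfK w0) -/eta h mul1r.
have /muP[n en etan] := heta.
pose q := \sum_(0 <= i < n) \sum_(j < i) eta ^+ j.
have hq : Zmu e q by do 2![apply: Zmu_sum => ? _]; apply/Zmu_mu/muX.
(* The factor [w^-1] reduces z - w to eta - 1, and the sign is there because (eta - 1) q = -n. *)
exists (- (w^-1 * q)), n; split=> //.
  by apply: ZmuN; apply: ZmuM => //; apply/Zmu_mu/muV.
have -> : z - w = (eta - 1) * w by rewrite mulrBl mul1r divfK.
rewrite mulrN -mulrA mulVKf // mulr_sumr.
rewrite (eq_bigr (fun i => eta ^+ i - 1)) => [|i _]; last by rewrite subrX1.
rewrite sumrB sum_unity_root // (negPf eta1) sub0r opprK.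
by rewrite sumr_const_nat subn0.
Qed.

Lemma mu_grading_eigen_1 f : kp_alg_aut e iR iZ f -> grading_of iR iZ f 1 1.
Proof. by move=> [_ f1 _ _]; rewrite /grading_of /eigen rmorph1 f1 (iZ1 hT) mulr1. Qed.

Hypothesis hR : forall d : nat, st_dvd d e -> injective (fun r : R => r *+ d).

Lemma sub_unity_root_regular z w x : mu e z -> mu e w -> z != w ->
  iZ (z - w) * x = 0 -> x = 0.
Proof.
move=> hz hw /(sub_unity_root_dvd hz hw)[v [n [hv en zwv]]] h.
have hzw : Zmu e (z - w) by apply: ZmuD; [|apply: ZmuN]; exact: Zmu_mu.
apply: (tensor_torsion_free hT hR en); rewrite -mulr_natl -(iZ_nat hT) -zwv.
by rewrite mulrC (iZM hT) // -mulrA h mulr0.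
Qed.

(** Applying f - w to a relation removes the term at w and multiplies the one at z by z - w;
    induction on the support finishes, as z - w is regular on R'. *)
Lemma eigen_indep f : kp_linear e iR iZ f -> mu_indep e (eigen iZ f).
Proof.
move=> fl; have fD := fl.1.
elim=> [|w s IH] g //= /andP[ws us] ms gE; rewrite big_cons => g0.
have mw : mu e w by apply: ms; rewrite mem_head.
have ms' z : z \in s -> mu e z by move=> zs; apply: ms; rewrite inE zs orbT.
have gE' z : z \in s -> eigen iZ f z (g z) by move=> zs; apply: gE; rewrite inE zs orbT.
have mB z : z \in s -> Zmu e (z - w).
  by move=> zs; apply: ZmuD; [|apply: ZmuN]; apply: Zmu_mu; auto.
have s0 : \sum_(z <- s) iZ (z - w) * g z = 0.
  transitivity (f (g w + \sum_(z <- s) g z) - iZ w * (g w + \sum_(z <- s) g z)).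
    rewrite fD (addmap_sum fD) (gE w) ?mem_head // mulrDr opprD addrACA subrr add0r mulr_sumr -sumrB.
    rewrite !big_seq; apply: eq_bigr => z zs.
    by rewrite (gE' z) // (iZB hT) ?mulrBl //; apply: Zmu_mu; auto.
  by rewrite g0 (addmap0 fD) mulr0 subrr.
have gs z : z \in s -> g z = 0.
  move=> zs; apply: (@sub_unity_root_regular z w) => //; first exact: ms'.
    by apply: contraNneq ws => <-.
  apply: (IH (fun z => iZ (z - w) * g z)) => // y ys.
  rewrite /eigen (kp_linearZ _ fl (mB y ys)). rewrite (gE' y ys) !mulrA.
  by rewrite (iZ_central hT _ (mB y ys)).
move=> z; rewrite inE => /orP[/eqP->|/gs //].
by move: g0; rewrite big_seq big1 ?addr0.
Qed.

(* The relation tau sigma tau^-1 = sigma^a turns an eigenvector x for z into another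
   one, tau^-1 x; by uniqueness of the decomposition the components of a tau-invariant
   element are tau-invariant. *)
Lemma X_e_twist_fixed f nu s g : X_e e iR iZ f -> (forall z, z \in s -> mu e z) ->
  uniq s -> (forall z, z \in s -> eigen iZ f z (g z)) ->
  twist hT nu (\sum_(z <- s) g z) = \sum_(z <- s) g z ->
  forall z, z \in s -> twist hT nu (g z) = g z.
Proof.
move=> [[fl _ _ _] [_ ind] Xf] ms us gE sfix.
pose nu' : {rmorphism algC -> algC} := algC_invaut nu.
have TK : cancel (twist hT nu) (twist hT nu') by apply: twistK; exact: algC_autK.
have TK' : cancel (twist hT nu') (twist hT nu) by apply: twistK; exact: algC_invautK.
have [_ fpow] := Xf _ (aut_exp_zhat_unit e nu) _ _ (twist_is_tau hT nu) TK TK'.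
pose g' z := twist hT nu' (g z) - g z.
suff g'0 z : z \in s -> g' z = 0.
  by move=> z /g'0 /eqP; rewrite subr_eq0 => /eqP h; rewrite -[in LHS]h TK'.
move: z; apply: ind => // [z zs|].
  have hz := ms z zs; have [n [zP en]] := hz.
  apply: (eigenD fl.1); last by apply: (eigenN fl.1); exact: gE.
  (* The twisted map has eigenvalue z^a = nu z on [g z]; the inverse twist is semilinear and brings
     this eigenvalue back to z. *)
  have := fpow z n (g z) zP en (gE z zs).
  rewrite -(aut_expE nu en.1 (prim_expr_order zP)) => /(congr1 (twist hT nu')).
  rewrite /= TK twist_semilinear; last exact/Zmu_mu/mu_aut.
  by rewrite (_ : nu' (nu z) = z) //; exact: algC_autK.
rewrite sumrB -(addmap_sum (twistD hT nu')) -{1}sfix TK subrr //.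
Qed.

Lemma X_e_mu_grading f : X_e e iR iZ f -> mu_grading e (grading_of iR iZ f).
Proof.
move=> Xf; have [fA [dec ind] _] := Xf; have [fl f1 fM _] := fA; have fD := fl.1.
split=> [z mz|r|s g us ms gE s0 z zs||z w r s mz mw].
- split=> [|r s|a r]; rewrite /grading_of.
  + by rewrite rmorph0; exact: eigen0.
  + by rewrite rmorphD; exact: eigenD.
  rewrite /eigen => Er; have := fl.2 a 1 (iR r) (Zmu1 e).
  rewrite (iZ1 hT) mulr1 -rmorphM mulr_algl Er mulrA.
  by rewrite -(iZ_central hT _ (Zmu_mu mz)) -mulrA -rmorphM mulr_algl.
- have [s [g [us ms gE Er]]] := dec (iR r).
  (* [iR r] is fixed by every twist, hence so are its eigencomponents, and descent places them in
     R. *)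
  have hg z : exists q, z \in s -> g z = iR q.
    case: (boolP (z \in s)) => zs; last by exists 0.
    have [q ->] : exists q, g z = iR q; last by exists q.
    apply: (twist_fixed (hT := hT)) => // nu.
    by apply: (X_e_twist_fixed Xf ms us gE) => //; rewrite -Er twist_iR.
  have [h hE] := choice hg; exists s, h; split=> // [z zs|].
    by rewrite /grading_of -hE //; exact: gE.
  apply: (iR_inj hT); rewrite Er rmorph_sum !big_seq.
  by apply: eq_bigr => z zs; exact: hE.
- apply: (iR_inj hT); rewrite rmorph0.
  apply: (ind s (fun z => iR (g z)) us ms gE _ z zs).
  by rewrite -rmorph_sum s0 rmorph0.
- exact: mu_grading_eigen_1.
rewrite /grading_of /eigen rmorphM fM => -> ->.
rewrite (iZM hT) ?rmorphM; try exact: Zmu_mu.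
rewrite -!mulrA; congr (_ * _); rewrite !mulrA; congr (_ * _).
by rewrite (iZ_central hT) //; exact: Zmu_mu.
Qed.

Lemma X_e_sigma_of_grading f :
  X_e e iR iZ f -> sigma_of_grading e iR iZ (grading_of iR iZ f) f.
Proof.
move=> [[fl _ _ _] _ _] z r u mz Er hu; have hz := Zmu_mu mz.
rewrite -(iZ_central hT _ hu) (kp_linearZ _ fl) // Er (iZM hT) //.
by rewrite mulrA -(iZM hT) // mulrC -(iZM hT) // mulrC (iZ_central hT) ?mulrA //; exact: ZmuM.
Qed.

End Correspondence.

(** * Automorphisms from gradings *)

Section GradingToSigma.
Variables (e : steinitz) (k : comPzRingType) (R : algType k) (R' : pzRingType).
Variables (iR : {rmorphism R -> R'}) (iZ : algC -> R').
Hypothesis hT : is_tensor_Zmu e iR iZ.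
Variable G : algC -> R -> Prop.
Hypothesis hG : mu_grading e G.

Lemma grading0 z : mu e z -> G z 0.
Proof. by case: hG => h _ _ _ _ /h[]. Qed.

Lemma gradingD z r s : mu e z -> G z r -> G z s -> G z (r + s).
Proof. by case: hG => h _ _ _ _ /h[_ hD _]; exact: hD. Qed.

Lemma gradingZ z a r : mu e z -> G z r -> G z (a *: r).
Proof. by case: hG => h _ _ _ _ /h[_ _ hZ]; exact: hZ. Qed.

Lemma gradingN z r : mu e z -> G z r -> G z (- r).
Proof. by move=> hz hr; rewrite -scaleN1r; exact: gradingZ. Qed.

Lemma grading_indep : mu_indep e G.
Proof. by case: hG. Qed.

Lemma grading_decomp r : exists s g, mu_decomp e G r s g.
Proof. by case: hG => _ h _ _ _; exact: h. Qed.

Lemma grading_ind (P : R' -> Prop) :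
  P 0 -> (forall x y, P x -> P y -> P (x + y)) ->
  (forall z r w, mu e z -> G z r -> mu e w -> P (iR r * iZ w)) -> forall x, P x.
Proof.
move=> P0 PD PT; apply: (tensor_mu_ind hT) => // r w hw.
have [s [g [_ ms gE ->]]] := grading_decomp r.
rewrite rmorph_sum mulr_suml big_seq; elim/big_ind: _ => // z zs.
by apply: (PT z) => //; [exact: ms | exact: gE].
Qed.

(** The map is defined by decomposing r into homogeneous parts. Taking chi to be the identity gives
    sigma, and inversion gives its inverse. *)
Lemma graded_map_ex (chi : algC -> algC) : (forall z, mu e z -> mu e (chi z)) ->
  exists S : R' -> R', (forall x y, S (x + y) = S x + S y) /\
    forall z r u, mu e z -> G z r -> Zmu e u -> S (iR r * iZ u) = iR r * iZ (chi z * u).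
Proof.
move=> hchi.
have dex r : exists p : seq algC * (algC -> R), mu_decomp e G r p.1 p.2.
  by have [s [g h]] := grading_decomp r; exists (s, g).
have [d dE] := choice dex.
pose phi u z r := iR r * iZ (chi z * u).
pose f r u := \sum_(z <- (d r).1) phi u z ((d r).2 z).
have phi0 u z : phi u z 0 = 0 by rewrite /phi rmorph0 mul0r.
have fE r u s g : mu_decomp e G r s g -> f r u = \sum_(z <- s) phi u z (g z).
  by apply: (sum_mu_decomp_uniq grading0 gradingD gradingN grading_indep (phi0 u)); exact: dE.
have [||S [SD SE]] := @tensor_extend _ _ _ _ _ _ hT _ f.
- move=> u _ r s.
  have [ur _ _ _] := dE r; have [us _ _ _] := dE s.
  rewrite (fE _ _ _ _ (mu_decompD grading0 gradingD (dE r) (dE s))).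
  rewrite /f (@sum_extend0 _ _ (phi u) (d r).1 (undup ((d r).1 ++ (d s).1))) ?undup_uniq //; last first.
    by move=> z zs; rewrite mem_undup mem_cat zs.
  rewrite (@sum_extend0 _ _ (phi u) (d s).1 (undup ((d r).1 ++ (d s).1))) ?undup_uniq //; last first.
    by move=> z zs; rewrite mem_undup mem_cat zs orbT.
  by rewrite -big_split; apply: eq_bigr => z _; rewrite /phi rmorphD mulrDl.
- move=> r u v hu hv; rewrite /f -big_split !big_seq; apply: eq_bigr => z zs.
  have [_ ms _ _] := dE r; have hz := Zmu_mu (hchi _ (ms z zs)).
  by rewrite /phi mulrDr (iZD hT) ?mulrDr //; exact: ZmuM.
exists S; split=> // z r u hz hr hu.
by rewrite SE // (fE _ _ _ _ (mu_decomp1 hz hr)) big_seq1.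
Qed.

Lemma sigma_of_grading_unique f g : kp_linear e iR iZ f -> kp_linear e iR iZ g ->
  sigma_of_grading e iR iZ G f -> sigma_of_grading e iR iZ G g -> forall x, f x = g x.
Proof.
move=> [fD _] [gD _] fG gG; apply: grading_ind => [|x y hx hy|z r w hz hr hw].
- by rewrite (addmap0 fD) (addmap0 gD).
- by rewrite fD gD hx hy.
by rewrite (fG z) ?(gG z) //; exact: Zmu_mu.
Qed.

Variable sg : R' -> R'.
Hypothesis sgD : forall x y, sg (x + y) = sg x + sg y.
Hypothesis sgG : sigma_of_grading e iR iZ G sg.

Lemma sigma_kp_linear : kp_linear e iR iZ sg.
Proof.
split=> // a u x hu; elim/grading_ind: x => [|x y hx hy|z r w hz hr hw].
- by rewrite mulr0 (addmap0 sgD) mulr0.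
- by rewrite mulrDr !sgD mulrDr hx hy.
have hw' := Zmu_mu hw; have hz' := Zmu_mu hz.
rewrite (tensorM hT) // mulr_algl !(sgG hz) //; [|exact: gradingZ|exact: ZmuM].
by rewrite (tensorM hT) ?mulr_algl 1?mulrCA //; exact: ZmuM.
Qed.

Lemma sigma_iR z r : mu e z -> G z r -> eigen iZ sg z (iR r).
Proof.
move=> hz hr; have := sgG hz hr (Zmu1 e).
by rewrite (iZ1 hT) !mulr1 /eigen (iZ_central hT) //; exact: Zmu_mu.
Qed.

Lemma sigma_kp_alg_aut : kp_alg_aut e iR iZ sg.
Proof.
have G1 : G 1 1 by case: hG.
have GM z w r s : mu e z -> mu e w -> G z r -> G w s -> G (z * w) (r * s).
  by case: hG => _ _ _ _ h; exact: h.
split; first exact: sigma_kp_linear.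
- have := sigma_iR (mu1 e) G1.
  by rewrite /eigen rmorph1 (iZ1 hT) mulr1.
- move=> x y; elim/grading_ind: x => [|x x' hx hx'|z r w hz hr hw].
  + by rewrite mul0r (addmap0 sgD) mul0r.
  + by rewrite mulrDl !sgD hx hx' mulrDl.
  elim/grading_ind: y => [|y y' hy hy'|z' r' w' hz' hr' hw'].
  + by rewrite mulr0 (addmap0 sgD) mulr0.
  + by rewrite mulrDr !sgD hy hy' mulrDr.
  have [Zz Zw] := (Zmu_mu hz, Zmu_mu hw); have [Zz' Zw'] := (Zmu_mu hz', Zmu_mu hw').
  rewrite (tensorM hT) // (sgG (muM hz hz')) //; [|exact: GM|exact: ZmuM].
  rewrite (sgG hz) // (sgG hz') // (tensorM hT); [|exact: ZmuM|exact: ZmuM].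
  by rewrite mulrACA.
(* The inverse of sigma multiplies R_z (x) Z[mu_e] by z^-1. *)
have [S [SD SE]] := graded_map_ex (@muV e).
exists S => x; elim/grading_ind: x => [|x y hx hy|z r w hz hr hw].
- by rewrite (addmap0 sgD) (addmap0 SD).
- by rewrite sgD SD hx hy.
- have [Zz Zw] := (Zmu_mu hz, Zmu_mu hw).
  by rewrite (sgG hz) // (SE z) ?mulKf //; [exact: mu_neq0 hz | exact: ZmuM].
- by rewrite (addmap0 SD) (addmap0 sgD).
- by rewrite SD sgD hx hy.
have [Zz Zw] := (Zmu_mu (muV hz), Zmu_mu hw).
by rewrite (SE z) // (sgG hz) ?mulVKf //; [exact: mu_neq0 hz | exact: ZmuM].
Qed.

(* The additive subgroup R_z (x) Z[mu_e] of R', given by its induction principle. *)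
Definition tensor_component (z : algC) (x : R') : Prop := forall P : R' -> Prop,
  P 0 -> (forall a b, P a -> P b -> P (a + b)) ->
  (forall r u, G z r -> mu e u -> P (iR r * iZ u)) -> P x.

Lemma tensor_component0 z : tensor_component z 0.
Proof. by []. Qed.

Lemma tensor_componentD z x y :
  tensor_component z x -> tensor_component z y -> tensor_component z (x + y).
Proof. by move=> hx hy P P0 PD PT; apply: (PD); [exact: hx | exact: hy]. Qed.

Lemma tensor_component_eigen z x : mu e z -> tensor_component z x -> eigen iZ sg z x.
Proof.
move=> hz; apply=> [|a b|r u hr hu]; [exact: eigen0|exact: eigenD|].
have [Zz Zu] := (Zmu_mu hz, Zmu_mu hu).
by rewrite /eigen (sgG hz) // (iZM hT) // !mulrA (iZ_central hT _ Zz).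
Qed.

Lemma tensor_component_decomp x : exists s g, mu_decomp e tensor_component x s g.
Proof.
elim/grading_ind: x => [|x y [s [g Dx]] [t [h Dy]]|z r w hz hr hw].
- by exists [::], (fun=> 0); split; rewrite ?big_nil.
- exists (undup (s ++ t)), (fun z => extend0 s g z + extend0 t h z).
  apply: mu_decompD => //; first by move=> z _; exact: tensor_component0.
  by move=> z a b _; exact: tensor_componentD.
exists [:: z], (fun=> iR r * iZ w); apply: mu_decomp1 => //.
by move=> P _ _; exact.
Qed.

Hypothesis hR : forall d : nat, st_dvd d e -> injective (fun r : R => r *+ d).

Lemma eigen_decomp_hom z x s g : mu e z -> eigen iZ sg z x ->
  mu_decomp e (eigen iZ sg) x s g -> x = extend0 s g z.
Proof.
apply: mu_decomp_hom => [w _|w a b _|w a _|].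
- exact: eigen0.
- exact: eigenD.
- exact: eigenN.
exact: (eigen_indep hT hR sigma_kp_linear).
Qed.

(** A decomposition of x into elements of the R_w (x) Z[mu_e] is also one into eigenvectors, so by
    uniqueness x is its own component at z. *)
Lemma eigen_tensor_component z x : mu e z -> eigen iZ sg z x -> tensor_component z x.
Proof.
move=> hz hx; have [s [g [us ms gE Ex]]] := tensor_component_decomp x.
have -> : x = extend0 s g z.
  apply: eigen_decomp_hom hz hx _; split=> // w ws.
  by apply: tensor_component_eigen; [exact: ms | exact: gE].
by rewrite /extend0; case: ifP => [/gE //|_]; exact: tensor_component0.
Qed.

(** The homogeneous parts of r map to eigenvectors; uniqueness in R' and injectivity of [iR]
    identify r with its part of degree z. *)
Lemma eigen_iR z r : mu e z -> eigen iZ sg z (iR r) -> G z r.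
Proof.
move=> hz hr; have [s [g [us ms gE Er]]] := grading_decomp r.
have : iR r = extend0 s (iR \o g) z.
  apply: eigen_decomp_hom hz hr _; split=> // [w ws|].
    by apply: sigma_iR; [exact: ms | exact: gE].
  by rewrite Er rmorph_sum.
rewrite /extend0 /=; case: ifP => [/gE hg /(iR_inj hT) -> //|_].
by rewrite -(rmorph0 iR) => /(iR_inj hT) ->; exact: grading0.
Qed.

Lemma sigma_mu_diag : mu_diag e iZ sg.
Proof.
split=> [x|]; last exact: (eigen_indep hT hR sigma_kp_linear).
have [s [g [us ms gE Ex]]] := tensor_component_decomp x.
exists s, g; split=> // w ws.
by apply: tensor_component_eigen; [exact: ms | exact: gE].
Qed.

(** [is_tau] refers to the exact order m of w; compatibility of the family a allows any multiple n
    of m that divides e. *)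
Lemma tau_level (a : nat -> nat) T n r w : zhat_unit e a -> is_tau e iR iZ a T ->
  st_dvd n e -> w ^+ n = 1 -> T (iR r * iZ w) = iR r * iZ (w ^+ a n).
Proof.
move=> [[_ ac] _] [_ hTa] en wn; have [m wP mn] := prim_order_exists en.1 wn.
have em := st_dvd_dvdn mn en.
by rewrite (hTa r w m) // (ac n m) ?em.1 // (prim_expr_mod wP).
Qed.

Lemma sigma_pow_endo (a : nat -> nat) T Tinv : zhat_unit e a -> is_tau e iR iZ a T ->
  cancel T Tinv -> cancel Tinv T -> is_pow_endo e iZ sg a (T \o sg \o Tinv).
Proof.
move=> ha hTau TK TK'; have [TD _] := hTau.
have TinvD x y : Tinv (x + y) = Tinv x + Tinv y.
  by apply: (can_inj TK); rewrite TD !TK'.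
split=> [x y|z n x zP en hx]; first by rewrite /= TinvD sgD TD.
have hz : mu e z by exists n.
have zn := prim_expr_order zP.
(* Here y stands for [Tinv x]. The three conditions are additive in x, so pure tensors r (x) u with
   r in R_z suffice. *)
pose P x := exists y, [/\ T y = x, sg y = iZ z * y & T (iZ z * y) = iZ (z ^+ a n) * x].
suff [y [Ty sy Tzy]] : P x by rewrite /= -Ty TK sy Tzy Ty.
apply: (eigen_tensor_component hz hx).
- exists 0; split; first exact: addmap0.
    by rewrite (addmap0 sgD) mulr0.
  by rewrite mulr0 (addmap0 TD) mulr0.
- move=> _ _ [x1 [<- s1 T1]] [x2 [<- s2 T2]]; exists (x1 + x2); split; first exact: TD.
    by rewrite sgD s1 s2 mulrDr.
  by rewrite mulrDr TD T1 T2 mulrDr.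
move=> r u hr hu; have /muP[m em um] := hu.
pose N := lcmn n m; have eN : st_dvd N e := st_dvd_lcmn en em.
have uN : u ^+ N = 1 := expr1_dvdn (dvdn_lcmr n m) um.
have zN : z ^+ N = 1 := expr1_dvdn (dvdn_lcml n m) zn.
have aNn : z ^+ a N = z ^+ a n.
  have [[_ ac] _] := ha; rewrite (ac N n eN) ?dvdn_lcml ?(prim_expr_mod zP) //.
  by case: en.
have coN : coprime (a N) N by case: ha => _; exact.
(* The preimage of r (x) u under T is r (x) w with w^(a N) = u; by Euler's theorem
   [a N ^ (totient N).-1] is the inverse of [a N] modulo N. *)
pose w := u ^+ (a N ^ (totient N).-1).
have wN : w ^+ N = 1 by rewrite /w exprAC uN expr1n.
have wa : w ^+ a N = u.
  rewrite /w -exprM -expnSr prednK; last by rewrite totient_gt0; case: eN.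
  by rewrite -(expr_mod _ uN) Euler_exp_totient // (expr_mod _ uN) expr1.
have hw : mu e w by exact: muX.
have Zz := Zmu_mu hz; have Zw := Zmu_mu hw; have Zu := Zmu_mu hu.
exists (iR r * iZ w); split.
- by rewrite (tau_level _ ha hTau eN wN) wa.
- by rewrite (sgG hz) // mulrA (iZ_central hT _ Zz) -mulrA (iZM hT).
rewrite mulrA (iZ_central hT _ Zz) -mulrA -(iZM hT) //.
rewrite (tau_level _ ha hTau eN); last by rewrite exprMn zN wN mulr1.
have Za : Zmu e (z ^+ a n) by apply/Zmu_mu/muX.
by rewrite exprMn wa aNn (iZM hT) // !mulrA (iZ_central hT _ Za).
Qed.

Lemma sigma_X_e : X_e e iR iZ sg.
Proof.
split; [exact: sigma_kp_alg_aut | exact: sigma_mu_diag |].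
by move=> a ha T Tinv; exact: sigma_pow_endo.
Qed.

End GradingToSigma.

Theorem mainTheorem5 (e : steinitz) (k : comPzRingType) (R : algType k)
  (hR : forall d : nat, st_dvd d e -> injective (fun r : R => r *+ d))
  (R' : pzRingType) (iR : {rmorphism R -> R'}) (iZ : algC -> R')
  (hT : is_tensor_Zmu e iR iZ) :
  [/\ (* grading |-> sigma is well defined, lands in X_e, and
         sigma |-> grading undoes it *)
      (forall G, mu_grading e G ->
         exists s : R' -> R',
           [/\ X_e e iR iZ s, sigma_of_grading e iR iZ G s,
               (forall t, kp_linear e iR iZ t -> sigma_of_grading e iR iZ G t ->
                  forall x, t x = s x) &
               (forall z, mu e z -> forall r, G z r <-> grading_of iR iZ s z r)]),
      (* sigma |-> grading is well defined *)
      (forall s, X_e e iR iZ s -> mu_grading e (grading_of iR iZ s)) &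
      (* grading |-> sigma undoes sigma |-> grading *)
      (forall s, X_e e iR iZ s -> sigma_of_grading e iR iZ (grading_of iR iZ s) s)].
Proof.
split=> [G hG||]; [|exact: X_e_mu_grading|exact: X_e_sigma_of_grading].
have [S [SD SG]] := graded_map_ex hT hG (chi := id) (fun _ h => h).
exists S; split=> //; first exact: sigma_X_e hG _ SD SG hR.
  move=> t tl tG; exact: (sigma_of_grading_unique hT hG tl (sigma_kp_linear hT hG SD SG) tG SG).
move=> z hz r; split; first exact: sigma_iR hz.
exact: eigen_iR hG _ SD SG hR _ _ hz.
Qed.
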